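(* Let $(M,\omega)$ be a closed symplectic manifold such that the homomorphism $e:\Gamma\to\pi_1(M)$ is injective. Then a symplectic circle action on $(M,\omega)$ is Hamiltonian if and only if it has fixed points.
   Context: $M$ is connected. A smooth action of $S^1=\mathbb{R}/\mathbb{Z}$ on $M$, generated by the vector field $X$, is symplectic if the $1$-form $\iota_X\omega$ is closed, and Hamiltonian if $\iota_X\omega$ is exact. A fixed point of the action is a point fixed by all of $S^1$. $\mathrm{Symp}_0(M,\omega)$ is the identity component of the group of symplectic diffeomorphisms of $(M,\omega)$. For a smooth path $\{\psi_t\}_{t\in[0,1]}$ in $\mathrm{Symp}_0(M,\omega)$ with $\psi_0=\mathrm{id}$, generated by the time-dependent vector field $X^t$, the flux is $\widetilde{\mathrm{Flux}}(\{\psi_t\})=\int_0^1[\iota_{X^t}\omega]\,dt\in H^1(M;\mathbb{R})$; it depends only on the homotopy class of the path with fixed endpoints, and defines a homomorphism on the universal cover of $\mathrm{Symp}_0(M,\omega)$. The flux group $\Gamma\subset H^1(M;\mathbb{R})$ is the image of $\pi_1(\mathrm{Symp}_0(M,\omega),\mathrm{id})$ under $\widetilde{\mathrm{Flux}}$. The evaluation homomorphism $ev:\pi_1(\mathrm{Symp}_0(M,\omega),\mathrm{id})\to\pi_1(M,x_0)$ is $ev([\{\psi_t\}])=[\{\psi_t(x_0)\}]$; its image lies in the center of $\pi_1(M,x_0)$ and the maps for different base points are identified. The $e$-homomorphism $e:\Gamma\to\pi_1(M)$ is the well-defined homomorphism determined by $e(\widetilde{\mathrm{Flux}}(\{\psi_t\}))=ev([\{\psi_t\}])$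 for every loop $\{\psi_t\}$ in $\mathrm{Symp}_0(M,\omega)$ based at $\mathrm{id}$. *)

(* Defs.v *)
From HB Require Import structures.
From mathcomp Require Import all_boot all_order all_algebra.
From mathcomp Require Import generic_quotient ring_quotient.
From mathcomp Require Import lra.
From mathcomp Require Import all_classical all_reals all_analysis.

Set Implicit Arguments.
Unset Strict Implicit.
Unset Printing Implicit Defensive.

Import Order.TTheory GRing.Theory Num.Theory.
Import numFieldNormedType.Exports.

Local Open Scope classical_set_scope.
Local Open Scope ring_scope.
Local Open Scope quotient_scope.

Section Smooth.
Context {R : realType} {V W : normedModType R}.

Definition iterD (vs : seq V) (f : V -> W) : V -> W :=
  foldr (fun v g => (fun x => 'D_v g x)) f vs.

(* On an open set of a finite-dimensional space this is C^oo: every iterated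
   directional derivative exists and is Frechet differentiable. *)
Definition smooth_on (U : set V) (f : V -> W) : Prop :=
  forall vs x, U x -> differentiable (iterD vs f) x.

Lemma near_eq_differentiable (f g : V -> W) (x : V) :
  (\forall y \near x, f y = g y) -> differentiable f x -> differentiable g x.
Proof.
move=> fg df; have [cdf] := (diff_locallyP _ _).1 df.
move=> /eqaddoP fE.
have gE : g \o shift x = cst (g x) + 'd f x +o_ 0 id.
  apply/eqaddoP => e e0; have := fE e e0.
  have : \forall y \near 0, f (y + x) = g (y + x).
    by move: fg; rewrite (near_shift 0) subr0.
  apply: filterS2 => y E; rewrite /= -![(_ + _ : _ -> _) _]/(_ + _).
  by rewrite -![(- _ : _ -> _) _]/(- _) /= /cst E (nbhs_singleton fg).
have E := diff_unique cdf gE.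
by apply/diff_locallyP; rewrite E.
Qed.

Lemma iterDB (U : set V) (f g : V -> W) (vs : seq V) (x : V) :
  open U -> smooth_on U f -> smooth_on U g -> U x ->
  iterD vs (f \- g) x = iterD vs f x - iterD vs g x.
Proof.
move=> oU sf sg; elim: vs x => [//|v vs IH] x Ux /=.
rewrite -deriveB; [|exact/diff_derivable/sf|exact/diff_derivable/sg].
apply: near_eq_derive; apply: filterS (open_nbhs_nbhs (conj oU Ux)) => y Uy.
exact: IH.
Qed.

Lemma smooth_onB (U : set V) (f g : V -> W) :
  open U -> smooth_on U f -> smooth_on U g -> smooth_on U (f \- g).
Proof.
move=> oU sf sg vs x Ux.
apply: (@near_eq_differentiable (iterD vs f \- iterD vs g)).
  apply: filterS (open_nbhs_nbhs (conj oU Ux)) => y Uy.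
  exact/esym/(iterDB _ oU).
by apply: differentiableB; [exact: sf|exact: sg].
Qed.

Lemma smooth_on_cst (U : set V) (c : W) : smooth_on U (cst c).
Proof.
have [d dE] : exists d, forall vs, iterD vs (cst c) = cst (if vs is _ :: _ then d else c).
  exists 0; elim=> [//|v vs IH]; apply/funext => x /=.
  by rewrite IH derive_cst.
by move=> vs x _; rewrite dE; exact: differentiable_cst.
Qed.

End Smooth.

Section Manifold.
Context {R : realType} {n : nat}.
Local Notation E := 'rV[R]_n.

Record chart (M : topologicalType) := Chart {
  dom : set M;
  img : set E;
  fwd :> M -> E;
  inv : E -> M;
  dom_open : open dom;
  img_open : open img;
  fwd_img : forall p, dom p -> img (fwd p);
  inv_dom : forall x, img x -> dom (inv x);
  fwdK : forall p, dom p -> inv (fwd p) = p;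
  invK : forall x, img x -> fwd (inv x) = x;
  fwd_continuous : forall p, dom p -> {for p, continuous fwd};
  inv_continuous : forall x, img x -> {for x, continuous inv} }.

Record manifold := Manifold {
  carrier :> topologicalType;
  atlas : set (chart carrier);
  chart_at : carrier -> chart carrier;
  atlas_chart_at : forall p, atlas (chart_at p);
  dom_chart_at : forall p, dom (chart_at p) p;
  atlas_compat : forall c c', atlas c -> atlas c' ->
    smooth_on (img c `&` inv c @^-1` dom c') (c' \o inv c);
  manifold_hausdorff : hausdorff_space carrier;
  manifold_second_countable : @second_countable carrier }.

End Manifold.
Arguments manifold : clear implicits.

Section SmoothMaps.
Context {R : realType} {n : nat} (M : manifold R n).
Local Notation E := 'rV[R]_n.

Definition smooth_fun (h : M -> R) : Prop :=
  forall c, atlas c -> smooth_on (img c) (h \o inv c : E -> R^o).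

Definition smooth_map (f : M -> M) : Prop :=
  continuous f /\ forall c c', atlas c -> atlas c' ->
    smooth_on [set x | img c x /\ dom c' (f (inv c x))] (c' \o f \o inv c).

(* smooth maps R x M -> M *)
Definition smooth_family (F : R -> M -> M) : Prop :=
  continuous (fun z : R * M => F z.1 z.2) /\
  forall c c', atlas c -> atlas c' ->
    smooth_on [set z : R^o * E | img c z.2 /\ dom c' (F z.1 (inv c z.2))]
      (fun z : R^o * E => c' (F z.1 (inv c z.2))).

(* The tangent space at p is E, identified through the chart chart_at p.
   The vector with components v at x in the chart c is the following vector
   at inv c x. *)
Definition frame (c : chart M) (x v : E) : E :=
  'd (chart_at (inv c x) \o inv c) x v.

Definition tangent_map (f : M -> M) (p : M) (v : E) : E :=
  'd (chart_at (f p) \o f \o inv (chart_at p)) (chart_at p p) v.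

Definition dfun (h : M -> R) (p : M) (v : E) : R :=
  'd (h \o inv (chart_at p) : E -> R^o) (chart_at p p) v.

Definition velocity (g : R -> M) (t : R) : E :=
  derive1 (fun s => chart_at (g t) (g s)) t.

End SmoothMaps.

Section Forms.
Context {R : realType} {n : nat} (M : manifold R n).
Local Notation E := 'rV[R]_n.

Definition vfield := M -> E.
Definition tensor1 := M -> E -> R.
Definition tensor2 := M -> E -> E -> R.
HB.instance Definition _ := GRing.Zmodule.on tensor1.

Definition coord1 (c : chart M) (a : tensor1) (x v : E) : R :=
  a (inv c x) (frame c x v).
Definition coord2 (c : chart M) (w : tensor2) (x u v : E) : R :=
  w (inv c x) (frame c x u) (frame c x v).

Definition one_form (a : tensor1) : Prop :=
  (forall p, scalar (a p)) /\
  (forall c v, atlas c ->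
     smooth_on (img c) (fun x => coord1 c a x v : R^o)).

Definition two_form (w : tensor2) : Prop :=
  [/\ forall p u, scalar (w p u), forall p v, scalar (w p ^~ v),
      forall p v, w p v v = 0 &
      forall c u v, atlas c ->
        smooth_on (img c) (fun x => coord2 c w x u v : R^o)].

(* exterior derivatives, in the coordinates of c, on constant vector fields *)
Definition d1 (c : chart M) (a : tensor1) (x u v : E) : R :=
  'D_u (fun y => coord1 c a y v : R^o) x -
  'D_v (fun y => coord1 c a y u : R^o) x.
Definition d2 (c : chart M) (w : tensor2) (x u v z : E) : R :=
  'D_u (fun y => coord2 c w y v z : R^o) x +
  'D_v (fun y => coord2 c w y z u : R^o) x +
  'D_z (fun y => coord2 c w y u v : R^o) x.

Definition closed_one_form (a : tensor1) : Prop :=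
  one_form a /\
  forall c x u v, atlas c -> img c x -> d1 c a x u v = 0.

Definition exact_one_form (a : tensor1) : Prop :=
  exists2 h : M -> R, smooth_fun h & a = dfun h.

Definition symplectic_form (w : tensor2) : Prop :=
  [/\ two_form w,
      forall c x u v z, atlas c -> img c x -> d2 c w x u v z = 0 &
      forall p u, (forall v, w p u v = 0) -> u = 0].

Definition interior (X : vfield) (w : tensor2) : tensor1 :=
  fun p v => w p (X p) v.

Definition pullback2 (f : M -> M) (w : tensor2) : tensor2 :=
  fun p u v => w (f p) (tangent_map f p u) (tangent_map f p v).

Definition closed1_pred : {pred tensor1} := fun a => `[< closed_one_form a >].

Fact closed1_zmod_closed : zmod_closed closed1_pred.
Proof.
split=> [|a b /asboolP [[la sa] ca] /asboolP [[lb sb] cb]]; apply/asboolP.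
  split; first split.
  - by move=> p k u v; rewrite /= mulr0 addr0.
  - by move=> c v _; exact: smooth_on_cst.
  by move=> c x u v _ _; rewrite /d1 !derive_cst subrr.
split; first split.
- move=> p k u v; rewrite -[LHS]/(a p _ - b p _) la lb.
  rewrite -[in RHS]/(a p u - b p u) -[in RHS]/(a p v - b p v).
  by rewrite mulrBr opprD addrACA.
- by move=> c v ac; apply: smooth_onB;
    [exact: img_open|exact: sa|exact: sb].
move=> c x u v ac ix; have := ca c x u v ac ix; have := cb c x u v ac ix.
rewrite /d1.
have dE g k w : smooth_on (img c) (g : E -> R^o) ->
    smooth_on (img c) (k : E -> R^o) ->
    'D_w ((g : E -> R^o) \- k) x = 'D_w (g : E -> R^o) x - 'D_w (k : E -> R^o) x.
  move=> sg sk; apply: deriveB; apply: diff_derivable;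
    [exact: (sg [::])|exact: (sk [::])].
rewrite -![fun y => coord1 c (a - b) y _]/((fun y => coord1 c a y _) \-
  (fun y => coord1 c b y _)).
rewrite !dE; try by [exact: sa|exact: sb].
by move=> /subr0_eq-> /subr0_eq->; rewrite subrr.
Qed.

HB.instance Definition _ :=
  GRing.isZmodClosed.Build tensor1 closed1_pred closed1_zmod_closed.

Record closed1 := Closed1 { closed1_val :> tensor1; _ : closed1_val \in closed1_pred }.
HB.instance Definition _ := [isSub for closed1_val].
HB.instance Definition _ := [Choice of closed1 by <:].
HB.instance Definition _ := [SubChoice_isSubZmodule of closed1 by <:].

Definition exact1_pred : {pred closed1} := fun a => `[< exact_one_form a >].

Fact exact1_zmod_closed : zmod_closed exact1_pred.
Proof.
split=> [|a b /asboolP [h sh Ea] /asboolP [k sk Eb]]; apply/asboolP.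
  exists (cst 0) => [c _|]; first exact: smooth_on_cst.
  apply/funext => p; apply/funext => v; rewrite /dfun.
  by rewrite (diff_cst (0 : R^o)).
exists (h \- k) => [c ac|].
  by apply: smooth_onB; [exact: img_open|exact: sh|exact: sk].
apply/funext => p; apply/funext => v.
rewrite -[LHS]/((a : tensor1) p v - (b : tensor1) p v) Ea Eb /dfun.
have ip := fwd_img (dom_chart_at p).
have dh := sh _ (atlas_chart_at p) [::] _ ip.
have dk := sk _ (atlas_chart_at p) [::] _ ip.
rewrite -(deriveE v dh) -(deriveE v dk) -(deriveE v (differentiableB dh dk)).
exact/esym/(deriveB (diff_derivable dh) (diff_derivable dk)).
Qed.

HB.instance Definition _ :=
  GRing.isZmodClosed.Build closed1 exact1_pred exact1_zmod_closed.

Definition H1 := Quotient.quot exact1_pred.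
HB.instance Definition _ := GRing.Zmodule.on H1.
HB.instance Definition _ := EqQuotient.on H1.

Definition class1 (a : closed1) : H1 := \pi_H1 a.

End Forms.

Section FundamentalGroup.
Context {R : realType} {T : topologicalType}.
Local Notation I := (`[0, 1]%classic : set R).

Lemma within_comp (X Y : topologicalType) (A : set X) (B : set Y)
    (p : X -> Y) (f : Y -> T) :
  continuous p -> A `<=` p @^-1` B ->
  {within B, continuous f} -> {within A, continuous (f \o p)}.
Proof.
move=> cp AB /subspace_continuousP cf; apply/subspace_continuousP => x Ax.
apply: cvg_comp (cf _ (AB _ Ax)) => U /cp; rewrite /within /nbhs /=.
by apply: filterS => y Uy Ay; exact/Uy/AB.
Qed.

Lemma within_glue (X : topologicalType) (D : set X) (p : X -> R) (f g : X -> T) :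
  closed D -> continuous p ->
  {within D `&` [set x | p x <= 2^-1], continuous f} ->
  {within D `&` [set x | 2^-1 <= p x], continuous g} ->
  (forall x, D x -> p x = 2^-1 -> f x = g x) ->
  {within D, continuous (fun x => if p x <= 2^-1 then f x else g x)}.
Proof.
move=> cD cp cf cg fg.
have -> : D = (D `&` [set x | p x <= 2^-1]) `|` (D `&` [set x | 2^-1 <= p x]).
  rewrite -setIUr; apply/seteqP; split=> [x Dx|x []//].
  by split=> //; case: (lerP (p x) 2^-1) => h; [left|right; exact: ltW].
apply: withinU_continuous.
- by apply: closedI => //; apply: closed_comp (@closed_le _ _) => x _; exact: cp.
- by apply: closedI => //; apply: closed_comp (@closed_ge _ _) => x _; exact: cp.
- apply: subspace_eq_continuous cf => x; rewrite inE => -[Dx /= px].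
  by rewrite /from_subspace px.
- apply: subspace_eq_continuous cg => x; rewrite inE => -[Dx /= px].
  rewrite /from_subspace; case: ifPn => // px'; apply/esym/fg => //.
  by apply/eqP; rewrite eq_le px px'.
Qed.

Record loop (x0 : T) := Loop {
  loop_fun :> R -> T;
  loop_continuous : {within I, continuous loop_fun};
  loop_0 : loop_fun 0 = x0;
  loop_1 : loop_fun 1 = x0 }.

Context {x0 : T}.

HB.instance Definition _ := gen_eqMixin (loop x0).
HB.instance Definition _ := gen_choiceMixin (loop x0).

(* homotopy relative to the endpoints, parametrized by the first component *)
Definition homotopic (g0 g1 : loop x0) : Prop :=
  exists H : R * R -> T, [/\ {within I `*` I, continuous H},
    forall t, I t -> H (0, t) = g0 t,
    forall t, I t -> H (1, t) = g1 t &
    forall s, I s -> H (s, 0) = x0 /\ H (s, 1) = x0].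

Let I0 : I 0. Proof. by rewrite /= in_itv /= lexx ler01. Qed.
Let I1 : I 1. Proof. by rewrite /= in_itv /= lexx ler01. Qed.
Let cI : closed I. Proof. exact: itv_closed. Qed.
Let cII : closed (I `*` I). Proof.
have -> : I `*` I = fst @^-1` I `&` snd @^-1` I by [].
by apply: closedI; apply: closed_comp cI => z _; [exact: cvg_fst|exact: cvg_snd].
Qed.

Let IL t : I t -> t <= 2^-1 -> I (2 * t).
Proof. by rewrite /= !in_itv /= => /andP[? ?] ?; apply/andP; split; lra. Qed.
Let IR t : I t -> 2^-1 <= t -> I (2 * t - 1).
Proof. by rewrite /= !in_itv /= => /andP[? ?] ?; apply/andP; split; lra. Qed.
Let IN t : I t -> I (1 - t).
Proof. by rewrite /= !in_itv /= => /andP[? ?]; apply/andP; split; lra. Qed.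

Let cstar (X : topologicalType) (p : X -> R) : continuous p ->
  continuous (fun x => 2 * p x).
Proof. by move=> cp x; apply: cvgM; [exact: cvg_cst|exact: cp]. Qed.
Let cstar1 (X : topologicalType) (p : X -> R) : continuous p ->
  continuous (fun x => 2 * p x - 1).
Proof.
by move=> cp x; apply: cvgB; [exact: cstar|exact: cvg_cst].
Qed.

Let crev (X : topologicalType) (p : X -> R) : continuous p ->
  continuous (fun x => 1 - p x).
Proof. by move=> cp x; apply: cvgB; [exact: cvg_cst|exact: cp]. Qed.

Let cpair (X : topologicalType) (p q : X -> R) : continuous p -> continuous q ->
  continuous (fun x => (p x, q x)).
Proof. by move=> cp cq x; exact: (cvg_pair (cp x) (cq x)). Qed.

Let homotopicb (f g : loop x0) : bool := `[< homotopic f g >].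

Fact homotopic_refl : reflexive homotopicb.
Proof.
move=> g; apply/asboolP; exists (g \o snd); split=> //.
- apply: (@within_comp _ _ _ _ _ _ _ _ (@loop_continuous _ g)).
    by move=> z; exact: cvg_snd.
  by move=> z [].
- by move=> s _; rewrite /= loop_0 loop_1.
Qed.

Let homotopicS (f g : loop x0) : homotopic f g -> homotopic g f.
Proof.
move=> [H [cH H0 H1 He]].
exists (H \o (fun z : R * R => (1 - z.1, z.2))); split.
- apply: (@within_comp _ _ _ _ _ _ _ _ cH).
    apply: cpair; first by apply: crev => z; exact: cvg_fst.
    by move=> z; exact: cvg_snd.
  by move=> z [/IN ? ?]; split.
- by move=> t It /=; rewrite subr0 H1.
- by move=> t It /=; rewrite subrr H0.
- by move=> s Is; exact/He/IN.
Qed.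

Fact homotopic_sym : symmetric homotopicb.
Proof. by move=> f g; apply/asboolP/asboolP; exact: homotopicS. Qed.

Fact homotopic_trans : transitive homotopicb.
Proof.
move=> g f h /asboolP [H [cH H0 H1 He]] /asboolP [K [cK K0 K1 Ke]].
apply/asboolP.
exists (fun z : R * R => if z.1 <= 2^-1 then (H \o (fun z => (2 * z.1, z.2))) z
  else (K \o (fun z => (2 * z.1 - 1, z.2))) z); split => /=.
- apply: (@within_glue _ _ fst) => //.
  + by move=> z; exact: cvg_fst.
  + apply: (@within_comp _ _ _ _ _ _ _ _ cH).
      apply: cpair; first by apply: cstar => z; exact: cvg_fst.
      by move=> z; exact: cvg_snd.
    by move=> z [[? ?] /= ?]; split => //=; exact: IL.
  + apply: (@within_comp _ _ _ _ _ _ _ _ cK).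
      apply: cpair; first by apply: cstar1 => z; exact: cvg_fst.
      by move=> z; exact: cvg_snd.
    by move=> z [[? ?] /= ?]; split => //=; exact: IR.
  + by move=> [s t] [_ It] /= ->; rewrite divff// subrr H1// K0.
- by move=> t It; rewrite invr_ge0 ler0n mulr0 H0.
- move=> t It; rewrite ifF; last by apply/negbTE; rewrite -ltNge; lra.
  by rewrite (_ : 2 * 1 - 1 = 1) ?K1//; lra.
- move=> s Is; case: ifPn => s2; first exact/He/IL.
  by apply/Ke/IR => //; move: s2; rewrite -ltNge => /ltW.
Qed.

Canonical homotopic_equiv :=
  EquivRel homotopicb homotopic_refl homotopic_sym homotopic_trans.

Definition pi1 := {eq_quot homotopicb}.

Definition hclass (g : loop x0) : pi1 := \pi_pi1 g.

Definition cat_fun (f g : R -> T) (t : R) : T :=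
  if t <= 2^-1 then f (2 * t) else g (2 * t - 1).

Section Cat.
Variables f g : loop x0.

Fact cat_continuous : {within I, continuous (cat_fun f g)}.
Proof.
apply: (@within_glue _ _ id (f \o (fun t => 2 * t)) (g \o (fun t => 2 * t - 1))).
- by [].
- by move=> ?; exact: cvg_id.
- apply: (@within_comp _ _ _ _ _ _ _ _ (@loop_continuous _ f)).
    by apply: cstar => ?; exact: cvg_id.
  by move=> t [? ?]; exact: IL.
- apply: (@within_comp _ _ _ _ _ _ _ _ (@loop_continuous _ g)).
    by apply: cstar1 => ?; exact: cvg_id.
  by move=> t [? ?]; exact: IR.
- by move=> t _ /= ->; rewrite divff// subrr loop_1 loop_0.
Qed.

Fact cat_0 : cat_fun f g 0 = x0.
Proof. by rewrite /cat_fun invr_ge0 ler0n mulr0 loop_0. Qed.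

Fact cat_1 : cat_fun f g 1 = x0.
Proof.
rewrite /cat_fun ifF; last by apply/negbTE; rewrite -ltNge; lra.
by rewrite (_ : 2 * 1 - 1 = 1) ?loop_1//; lra.
Qed.

Definition loop_cat : loop x0 := Loop cat_continuous cat_0 cat_1.

End Cat.

Definition pi1_mul (a b : pi1) : pi1 := hclass (loop_cat (repr a) (repr b)).

Lemma pi1_mulE (f g : loop x0) :
  pi1_mul (hclass f) (hclass g) = hclass (loop_cat f g).
Proof.
have rh (h : loop x0) : homotopic (repr (hclass h)) h.
  by apply/asboolP/(@eqmodP _ homotopic_equiv); rewrite reprK.
apply/(@eqmodP _ homotopic_equiv)/asboolP.
have [H [cH H0 H1 He]] := rh f; have [K [cK K0 K1 Ke]] := rh g.
exists (fun z : R * R => if z.2 <= 2^-1 then (H \o (fun z => (z.1, 2 * z.2))) z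
  else (K \o (fun z => (z.1, 2 * z.2 - 1))) z); split => /=.
- apply: (@within_glue _ _ snd) => //.
  + by move=> z; exact: cvg_snd.
  + apply: (@within_comp _ _ _ _ _ _ _ _ cH).
      apply: cpair; last by apply: cstar => z; exact: cvg_snd.
      by move=> z; exact: cvg_fst.
    by move=> z [[? ?] /= ?]; split => //=; exact: IL.
  + apply: (@within_comp _ _ _ _ _ _ _ _ cK).
      apply: cpair; last by apply: cstar1 => z; exact: cvg_snd.
      by move=> z; exact: cvg_fst.
    by move=> z [[? ?] /= ?]; split => //=; exact: IR.
  + move=> [s t] [Is _] /= ->; rewrite divff// subrr.
    by rewrite (He _ Is).2 (Ke _ Is).1.
- move=> t It; rewrite /cat_fun; case: ifPn => t2; first exact/H0/IL.
  by apply/K0/IR => //; move: t2; rewrite -ltNge => /ltW.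
- move=> t It; rewrite /cat_fun; case: ifPn => t2; first exact/H1/IL.
  by apply/K1/IR => //; move: t2; rewrite -ltNge => /ltW.
- move=> s Is; rewrite invr_ge0 ler0n mulr0 (He _ Is).1; split=> //.
  rewrite ifF; last by apply/negbTE; rewrite -ltNge; lra.
  by rewrite (_ : 2 * 1 - 1 = 1) ?(Ke _ Is).2//; lra.
Qed.

End FundamentalGroup.
Arguments pi1 R {T} x0.

Section CInfinityTopology.
Context {R : realType} {n : nat} (M : manifold R n).
Local Notation E := 'rV[R]_n.

Definition selfmap := M -> M.

(* subbasic neighbourhoods of the (weak) C^oo topology: f and g are close in
   some iterated derivative, in charts, over a compact set *)
Definition Cinfty_subbase : set (set selfmap) :=
  [set U | exists (f : selfmap) (c c' : chart M) (K : set E) (vs : seq E) (e : R),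
    [/\ [/\ atlas c, atlas c' & smooth_map f],
        [/\ compact K, K `<=` img c & K `<=` [set x | dom c' (f (inv c x))]],
        0 < e &
        U = [set g | forall x, K x -> dom c' (g (inv c x)) /\
          `| iterD vs (c' \o g \o inv c) x - iterD vs (c' \o f \o inv c) x | < e]]].

HB.instance Definition _ := gen_eqMixin selfmap.
HB.instance Definition _ := gen_choiceMixin selfmap.
HB.instance Definition _ :=
  @isSubBaseTopological.Build selfmap (set selfmap) Cinfty_subbase id.

End CInfinityTopology.

Section Symplectic.
Context {R : realType} {n : nat} {M : manifold R n} (w : tensor2 M).
Local Notation I := (`[0, 1]%classic : set R).

Definition symplectomorphism (f : M -> M) : Prop :=
  [/\ smooth_map f,
      exists g, [/\ smooth_map g, cancel f g & cancel g f] &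
      pullback2 f w = w].

Definition Symp0 : set (selfmap M) :=
  connected_component [set f : selfmap M | symplectomorphism f] (id : M -> M).

(* Smooth loops based at the identity. Only the values on [0, 1] x M matter:
   smoothness on this closed set means having a smooth extension, which can be
   taken on all of R x M. *)
Record symp_loop := SympLoop {
  symp_loop_fun :> R -> M -> M;
  symp_loop_smooth : smooth_family symp_loop_fun;
  symp_loop_Symp0 : forall t, I t -> Symp0 (symp_loop_fun t);
  symp_loop_0 : symp_loop_fun 0 = id;
  symp_loop_1 : symp_loop_fun 1 = id }.

Definition generates (X : R -> vfield M) (F : R -> M -> M) : Prop :=
  forall t p, I t -> velocity (F ^~ p) t = X t (F t p).

(* the integral of the classes is the class of the pointwise integral *)
Definition has_flux (F : R -> M -> M) (a : H1 M) : Prop :=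
  exists (X : R -> vfield M) (b : closed1 M),
    [/\ generates X F,
        forall p v, (b : tensor1 M) p v =
          \int[lebesgue_measure]_(t in I) interior (X t) w p v &
        a = class1 b].

Definition flux_group : set (H1 M) :=
  [set a | exists F : symp_loop, has_flux F a].

Section Evaluation.
Variables (F : symp_loop) (x0 : M).

Fact eval_continuous : {within I, continuous (fun t => F t x0)}.
Proof.
apply: continuous_subspaceT => t.
have cF := (symp_loop_smooth F).1 (t, x0).
have cp : (fun s : R => (s, x0)) @ t --> (t, x0).
  exact: (cvg_pair cvg_id (cvg_cst x0)).
exact: (cvg_comp _ _ cp cF).
Qed.

Fact eval_0 : F 0 x0 = x0. Proof. by rewrite symp_loop_0. Qed.
Fact eval_1 : F 1 x0 = x0. Proof. by rewrite symp_loop_1. Qed.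

Definition ev : pi1 R x0 := hclass (Loop eval_continuous eval_0 eval_1).

End Evaluation.

Definition e_homomorphism (x0 : M) (e : flux_group -> pi1 R x0) : Prop :=
  (forall a b c : flux_group, val c = val a + val b ->
     e c = pi1_mul (e a) (e b)) /\
  (forall (F : symp_loop) (a : flux_group), has_flux F (val a) ->
     e a = ev F x0).

End Symplectic.

Section CircleActions.
Context {R : realType} {n : nat} {M : manifold R n} (w : tensor2 M).

(* A smooth action of R/Z, as a 1-periodic smooth action of R. *)
Definition circle_action (A : R -> M -> M) : Prop :=
  [/\ smooth_family A, A 0 = id,
      forall s t p, A (s + t) p = A s (A t p) & A 1 = id].

Definition action_field (A : R -> M -> M) : vfield M :=
  fun p => velocity (A ^~ p) 0.

Definition symplectic_action (A : R -> M -> M) : Prop :=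
  circle_action A /\ closed_one_form (interior (action_field A) w).

Definition hamiltonian_action (A : R -> M -> M) : Prop :=
  circle_action A /\ exact_one_form (interior (action_field A) w).

Definition fixed_point (A : R -> M -> M) (p : M) : Prop := forall t, A t p = p.

End CircleActions.

(* Main.v *)
(* A Hamiltonian function of the action has a maximum on the compact M; there
   i_X w vanishes, hence X does by nondegeneracy, and the point is fixed.

   Conversely let p be a fixed point. By Cartan's formula each A_t preserves w,
   and t |-> A_t is continuous for the C^oo topology, so A is a loop in Symp_0;
   since X does not depend on time its flux is the class of i_X w. Moving the base
   point x0 to p along a path contracts the orbit t |-> A_t x0, so e takes the same
   value on this flux and on the flux 0 of the constant loop. By injectivity the
   class of i_X w is 0. *)
From HB Require Import structures.
From mathcomp Require Import all_boot all_order all_algebra.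
From mathcomp Require Import generic_quotient ring_quotient ring lra.
From mathcomp Require Import all_classical all_reals all_analysis.
(* last, because [iterD] and [inv] are also names of the libraries above *)
Require Import Defs.

Set Implicit Arguments.
Unset Strict Implicit.
Unset Printing Implicit Defensive.

Import Order.TTheory GRing.Theory Num.Theory.
Import numFieldNormedType.Exports.

Local Open Scope classical_set_scope.
Local Open Scope ring_scope.

(** * Differential calculus *)

Section Calculus.
Context {R : realType}.
Implicit Types U V W : normedModType R.

(** Tangent vectors at [q] are coordinates in [chart_at q], a chart that may jump as [q] moves, so
    nothing can be differentiated along an orbit directly. Each such computation is first carried
    into one fixed chart by [frame]; there the action has a representative smooth in time and space
    jointly. Cartan's formula then becomes a product rule at time 0 for the coefficients of [w] and
    the spatial differential of this representative. Its analytic core is the symmetry of mixed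
    derivatives, which lets the time derivative pass through the spatial one. The group law carries
    the result to all times. It also replaces uniqueness for differential equations where a zero of
    the field is shown to be fixed: the velocity at time s is the image under the differential of
    A_s of the velocity at time 0. Since [e] sees a loop only through its flux, comparing its values
    at the two fluxes amounts to comparing two evaluated loops in the fundamental group at [x0]. *)

Lemma near_eq_diff {V W} (f g : V -> W) (x : V) :
  (\forall y \near x, f y = g y) -> differentiable f x ->
  'd f x = 'd g x :> (V -> W).
Proof.
move=> fg df; apply/funext => v.
rewrite -(deriveE v df) -(deriveE v (near_eq_differentiable fg df)).
exact: near_eq_derive.
Qed.

Lemma derive_comp {U V W} (f : U -> V) (g : V -> W) (x u : U) :
  differentiable f x -> differentiable g (f x) ->
  'D_u (g \o f) x = 'd g (f x) ('D_u f x).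
Proof.
move=> df dg; rewrite deriveE; last exact: differentiable_comp.
by rewrite diff_comp//= deriveE.
Qed.

(** Both sides are the derivative of one germ factored in two ways. This is how differentials are
    compared across charts. *)
Lemma diff_square {U V V' W} (f : U -> V) (g : V -> W) (f' : U -> V') (g' : V' -> W)
    (x u : U) (y : V) (y' : V') :
  f x = y -> f' x = y' -> differentiable f x -> differentiable g y ->
  differentiable f' x -> differentiable g' y' ->
  (\forall z \near x, g (f z) = g' (f' z)) ->
  'd g y ('d f x u) = 'd g' y' ('d f' x u).
Proof.
move=> <- <- df dg df' dg' E.
rewrite -(deriveE u df) -(deriveE u df') -derive_comp// -derive_comp//.
exact: near_eq_derive.
Qed.

Lemma diff_chain {U V W} (f : U -> V) (g : V -> W) (h : U -> W) (x u : U) (y : V) :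
  f x = y -> differentiable f x -> differentiable g y -> differentiable h x ->
  (\forall z \near x, h z = g (f z)) -> 'd h x u = 'd g y ('d f x u).
Proof.
move=> <- df dg dh E; rewrite -(deriveE u df) -(deriveE u dh) -derive_comp//.
exact: near_eq_derive.
Qed.

Lemma derive_slice {U V W} (f : U * V -> W) (t : U) (x v : V) :
  'D_v (fun y => f (t, y)) x = 'D_(0, v) f (t, x).
Proof.
rewrite /derive; set F := (X in X @ _); set G := (X in _ = lim (X @ _)).
suff -> : F = G by []; apply/funext => h; rewrite /F /G /=.
have -> : h *: (0, v) + (t, x) = (h *: 0 + t, h *: v + x) :> U * V by [].
by rewrite scaler0 add0r.
Qed.

Lemma derive_slicel {U V W} (f : U * V -> W) (t u : U) (x : V) :
  'D_u (fun s => f (s, x)) t = 'D_(u, 0) f (t, x).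
Proof.
rewrite /derive; set F := (X in X @ _); set G := (X in _ = lim (X @ _)).
suff -> : F = G by []; apply/funext => h; rewrite /F /G /=.
have -> : h *: (u, 0) + (t, x) = (h *: u + t, h *: 0 + x) :> U * V by [].
by rewrite scaler0 add0r.
Qed.

(** Directions with time component 0 recover the derivatives of a time slice from the whole family.
    Hence slices of a smooth family are smooth, and their derivatives vary continuously with
    time. *)
Lemma iterD_slice {U V W} (f : U * V -> W) (t : U) (vs : seq V) (x : V) :
  iterD vs (fun y => f (t, y)) x = iterD (map (pair 0) vs) f (t, x).
Proof.
elim: vs x => [//|v vs IH] x /=.
by rewrite -derive_slice; congr derive; apply/funext => y; exact: IH.
Qed.

Lemma differentiable_slice {U V W} (f : U * V -> W) (t : U) (x : V) :
  differentiable f (t, x) -> differentiable (fun y => f (t, y)) x.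
Proof.
by move=> df; apply: (@differentiable_comp _ _ _ _ (fun y : V => (t, y)) f).
Qed.

Lemma differentiable_slicel {U V W} (f : U * V -> W) (t : U) (x : V) :
  differentiable f (t, x) -> differentiable (fun s => f (s, x)) t.
Proof.
by move=> df; apply: (@differentiable_comp _ _ _ _ (fun s : U => (s, x)) f).
Qed.

Lemma is_derive_line {V W} (f : V -> W) (p q : V) (t : R) :
  differentiable f (p + t *: q) ->
  is_derive t (1 : R^o) (fun s : R^o => f (p + s *: q)) ('D_q f (p + t *: q)).
Proof.
move=> df.
have dl : is_diff (t : R^o) (fun s : R^o => p + s *: q) (fun s : R^o => s *: q).
  have := @is_diffD _ _ _ (cst p) (fun s : R^o => s *: q) _ _ (t : R^o)
    (is_diff_cst _ _) (is_diff_scalel _ _).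
  by rewrite add0r.
have d : differentiable (f \o (fun s : R^o => p + s *: q)) (t : R^o).
  by apply: differentiable_comp => //; exact: ex_diff.
apply: DeriveDef; first exact: diff_derivable.
have dl' : differentiable (fun s : R^o => p + s *: q) (t : R^o) by exact: ex_diff.
rewrite derive_comp //.
by rewrite (deriveE _ dl') diff_val scale1r deriveE.
Qed.


(** The second difference is an increment, over a step along [u], of a first difference along [v].
    The mean value theorem turns it into [h] times an increment of [G], which Frechet
    differentiability of [G] at the single point [x] controls; continuity of second derivatives does
    not enter. The quotient is symmetric in [u] and [v], whence Schwarz's theorem. *)
Lemma second_difference_cvg {V} (f : V -> R^o) (x u v : V) :
  (\forall y \near x, differentiable f y) ->
  differentiable (fun y => 'D_u f y) x ->
  (fun h : R => h ^- 2 * (f (x + h *: u + h *: v) - f (x + h *: u)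
     - f (x + h *: v) + f x)) @ 0^' --> 'D_v (fun y => 'D_u f y) x.
Proof.
move=> nf dG; set G := fun y => 'D_u f y; set d := 'd G x : V -> R^o.
apply/cvgrPdist_le => e e0.
(* The two points where [G] is expanded lie within |h|(|u| + |v|) and |h||u| of [x], so their errors
   add up to at most |h|(2|u| + |v|) times the tolerance; the 1 makes [N] positive. *)
set N := 2 * `|u| + `|v| + 1.
have N0 : 0 < N by rewrite ltr_wpDl// addr_ge0// mulr_ge0.
have e'0 : 0 < e / N by rewrite divr_gt0.
have /eqaddoP/(_ _ e'0) nG := diff_locally dG.
have {}nG : \forall z \near (0 : V), `|G (x + z) - G x - d z| <= e / N * `|z|.
  apply: filterS nG => z /=.
  rewrite -![(_ + _ : _ -> _) _]/(_ + _) -![(- _ : _ -> _) _]/(- _) /= /cst.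
  by rewrite [z + x]addrC -[(_ + _ : _ -> _) _]/(_ + _) opprD addrA.
have {}nf : \forall z \near (0 : V), differentiable f (x + z).
  by move: nf; rewrite (near_shift 0) subr0; apply: filterS => z /=; rewrite addrC.
have [r r0 Hr] : exists2 r : R, 0 < r & forall z : V, `|z| < r ->
    `|G (x + z) - G x - d z| <= e / N * `|z| /\ differentiable f (x + z).
  have [r r0 Hr] := (nbhs_ballP _ _).1 (filterI nG nf).
  by exists r => // z zr; apply: Hr; rewrite -ball_normE /= sub0r normrN.
near=> h.
have h0 : h != 0 by near: h; exact: nbhs_dnbhs_neq.
have hr : `|h| < r / N.
  near: h; apply: dnbhs0_lt; exact: divr_gt0.
have uN : `|u| <= N by rewrite /N; have := normr_ge0 u; have := normr_ge0 v; lra.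
have vN : `|v| <= N by rewrite /N; have := normr_ge0 u; have := normr_ge0 v; lra.
have small (t : R) : 0 <= t <= 1 -> `|(t * h) *: u| < r /\ `|(t * h) *: u + h *: v| < r.
  move=> /andP[t0 t1].
  have le1 : `|(t * h) *: u| <= `|h| * `|u|.
    by rewrite normrZ normrM (ger0_norm t0) ler_wpM2r// ler_piMl.
  have le2 : `|(t * h) *: u + h *: v| <= `|h| * (`|u| + `|v|).
    rewrite (le_trans (ler_normD _ _))// mulrDr [X in _ + X]normrZ lerD2r//.
  have hN : `|h| * N < r by rewrite -ltr_pdivlMr.
  split; [apply: le_lt_trans le1 _|apply: le_lt_trans le2 _];
    apply: le_lt_trans hN; rewrite ler_wpM2l// /N;
    have := normr_ge0 u; have := normr_ge0 v; lra.
(* the mean value theorem for k, whose increment on [0, 1] is the second difference *)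
pose k (t : R) : R := f (x + h *: v + t *: (h *: u)) - f (x + t *: (h *: u)).
pose dk (t : R) : R := h * (G (x + ((t * h) *: u + h *: v)) - G (x + (t * h) *: u)).
have kD (t : R) : 0 <= t <= 1 -> is_derive t 1 k (dk t).
  move=> /small[s1 s2].
  have d1 : differentiable f (x + h *: v + t *: (h *: u)).
    by rewrite -addrA (addrC (h *: v)) scalerA; exact: (Hr _ s2).2.
  have d2 : differentiable f (x + t *: (h *: u)).
    by rewrite scalerA; exact: (Hr _ s1).2.
  have := is_deriveB (is_derive_line d1) (is_derive_line d2).
  congr (is_derive _ _ _ _).
  have DE y : differentiable f y -> 'D_(h *: u) f y = h * G y.
    by move=> dy; rewrite /G !deriveE // linearZ.
  rewrite /dk !DE // mulrBr.
  by rewrite -[x + h *: v + _]addrA (addrC (h *: v)) !scalerA.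
have [t t01] : exists2 t, t \in `]0, 1[%R & k 1 - k 0 = dk t * (1 - 0).
  apply: MVT => // [t|]; first by rewrite in_itv/= => /andP[/ltW ? /ltW ?]; apply/kD/andP.
  apply: derivable_within_continuous => t; rewrite in_itv/= => t01.
  by have [] := kD t t01.
rewrite subr0 mulr1 /k !scale1r !scale0r !addr0 => kE.
have -> : f (x + h *: u + h *: v) - f (x + h *: u) - f (x + h *: v) + f x = dk t.
  by rewrite -kE (addrAC x (h *: u)); ring.
have [s1 s2] : `|(t * h) *: u| < r /\ `|(t * h) *: u + h *: v| < r.
  by apply: small; move: t01; rewrite in_itv/= => /andP[/ltW-> /ltW->].
have [E1 _] := Hr _ s1; have [E2 _] := Hr _ s2.
rewrite deriveE//.
have dE : d ((t * h) *: u + h *: v) - d ((t * h) *: u) = h * d v.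
  by rewrite /d linearD/= addrAC subrr add0r linearZ.
rewrite distrC /dk.
set a := G (x + _) in E2 *; set b := G (x + _) in E1 *.
have -> : h ^- 2 * (h * (a - b)) - 'd G x v
   = h^-1 * ((a - G x - d ((t * h) *: u + h *: v)) - (b - G x - d ((t * h) *: u))).
  have -> : (a - G x - d ((t * h) *: u + h *: v)) - (b - G x - d ((t * h) *: u))
     = (a - b) - h * d v by rewrite -dE; ring.
  by rewrite /d; field.
rewrite normrM normfV ler_pdivrMl ?normr_gt0//.
apply: le_trans (ler_normB _ _) _.
apply: le_trans (lerD E2 E1) _.
rewrite -mulrDr mulrAC ler_pdivrMr// (mulrC `|h|) -mulrA ler_wpM2l ?(ltW e0)//.
have le1 : `|(t * h) *: u| <= `|h| * `|u|.
  move: t01; rewrite in_itv/= => /andP[/ltW t0 /ltW t1].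
  by rewrite normrZ normrM (ger0_norm t0) ler_wpM2r// ler_piMl.
have le2 : `|(t * h) *: u + h *: v| <= `|h| * (`|u| + `|v|).
  by rewrite (le_trans (ler_normD _ _))// mulrDr [X in _ + X]normrZ lerD2r.
apply: le_trans (lerD le2 le1) _.
rewrite -mulrDr ler_wpM2l// /N; have := normr_ge0 u; have := normr_ge0 v; lra.
Unshelve. all: by end_near. Qed.

Lemma schwarz {V} (f : V -> R^o) (x u v : V) :
  (\forall y \near x, differentiable f y) ->
  differentiable (fun y => 'D_u f y) x -> differentiable (fun y => 'D_v f y) x ->
  'D_v (fun y => 'D_u f y) x = 'D_u (fun y => 'D_v f y) x.
Proof.
move=> nf du dv.
rewrite -(cvg_lim (@norm_hausdorff _ _) (second_difference_cvg (v := v) nf du)).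
rewrite -(cvg_lim (@norm_hausdorff _ _) (second_difference_cvg (v := u) nf dv)).
set F := (X in X @ _); set G := (X in _ = lim (X @ _)).
suff -> : F = G by []; apply/funext => h; rewrite /F /G (addrAC x (h *: u)).
by congr (_ * _); ring.
Qed.

Lemma derive_coord {V} {n} (f : V -> 'rV[R]_n) (x u : V) (j : 'I_n) :
  derivable f x u -> 'D_u f x 0 j = 'D_u (fun y => f y 0 j : R^o) x.
Proof. by move=> df; rewrite derive_mx// mxE. Qed.

Lemma differentiable_coordf {V} {n} (f : V -> 'rV[R]_n) (x : V) (j : 'I_n) :
  differentiable f x -> differentiable (fun y => f y 0 j : R^o) x.
Proof.
move=> df; apply: (@differentiable_comp _ _ _ _ f (fun M : 'rV[R]_n => M 0 j : R^o)) => //.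
exact: differentiable_coord.
Qed.

Lemma schwarz_rV {V} {n} (f : V -> 'rV[R]_n) (x u v : V) :
  (\forall y \near x, differentiable f y) ->
  differentiable (fun y => 'D_u f y) x -> differentiable (fun y => 'D_v f y) x ->
  'D_v (fun y => 'D_u f y) x = 'D_u (fun y => 'D_v f y) x.
Proof.
move=> nf Du Dv; apply/rowP => j.
have E w : \forall y \near x, 'D_w f y 0 j = 'D_w (fun y => f y 0 j : R^o) y.
  by apply: filterS nf => y dfy; rewrite derive_coord//; exact: diff_derivable.
set g := fun y => f y 0 j : R^o.
have Eu : ('D_v (fun y => 'D_u f y) x) 0 j = 'D_v (fun y => 'D_u g y) x.
  apply: etrans (derive_coord _ _) _; first exact: diff_derivable.
  exact: near_eq_derive (E u).
have Ev : ('D_u (fun y => 'D_v f y) x) 0 j = 'D_u (fun y => 'D_v g y) x.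
  apply: etrans (derive_coord _ _) _; first exact: diff_derivable.
  exact: near_eq_derive (E v).
apply: etrans Eu (etrans _ (esym Ev)).
apply: schwarz.
- by apply: filterS nf => y; exact: differentiable_coordf.
- exact: near_eq_differentiable (E u) (differentiable_coordf _ Du).
- exact: near_eq_differentiable (E v) (differentiable_coordf _ Dv).
Qed.

(** The product rule for a pairing that is linear in its second argument. Expanding that argument in
    the standard basis reduces it to products of real functions, so [L] only has to be derivable at
    each fixed vector. *)
Lemma is_derive_apply {V} {n} (L : V -> 'rV[R]_n -> R) (U : V -> 'rV[R]_n) (x z : V) :
  (forall y, scalar (L y)) ->
  (forall a, derivable (fun y => L y a : R^o) x z) -> derivable U x z ->
  is_derive x z (fun y => L y (U y) : R^o)
    ('D_z (fun y => L y (U x) : R^o) x + L x ('D_z U x)).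
Proof.
move=> linL dL dU.
have LE y a : L y a = \sum_(i < n) a 0 i * L y (delta_mx 0 i).
  pose l := GRing.isLinear.Build _ _ _ _ (L y) (linL y).
  pose Ly : {linear 'rV[R]_n -> R^o} := HB.pack (L y) l.
  rewrite -[L y]/(Ly : _ -> _) [in LHS](row_sum_delta a) linear_sum.
  by apply: eq_bigr => i _; rewrite linearZ.
pose g i y : R^o := U y 0 i * L y (delta_mx 0 i).
have gD i : is_derive x z (g i) (U x 0 i * 'D_z (fun y => L y (delta_mx 0 i) : R^o) x +
    'D_z U x 0 i * L x (delta_mx 0 i)).
  have h1 : is_derive x z (fun y => U y 0 i : R^o) ('D_z U x 0 i).
    rewrite derive_coord//; apply: derivableP.
    exact: (derivable_mxP _ _ _).1 dU 0 i.
  have h2 := derivableP (dL (delta_mx 0 i)).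
  have := is_deriveM h1 h2; congr (is_derive _ _ _ _); rewrite [X in _ + X]mulrC //.
have -> : (fun y => L y (U y) : R^o) = \sum_(i < n) g i.
  by apply/funext => y; rewrite LE fct_sumE.
have hE : 'D_z (fun y => L y (U x) : R^o) x
    = \sum_(i < n) U x 0 i * 'D_z (fun y => L y (delta_mx 0 i) : R^o) x.
  have -> : (fun y => L y (U x) : R^o)
      = \sum_(i < n) (U x 0 i \*: (fun y => L y (delta_mx 0 i) : R^o)).
    by apply/funext => y; rewrite LE fct_sumE.
  rewrite derive_sum; last by move=> i; apply: derivableZ.
  by apply: eq_bigr => i _; rewrite deriveZ.
have := is_derive_sum gD; congr (is_derive _ _ _ _).
by rewrite hE [X in _ = _ + X]LE big_split.
Qed.

(** Local in time, because an orbit is only known to stay in a given chart for short times. *)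
Lemma derive0_cst {n} (f : R -> 'rV[R]_n) (d s : R) :
  (forall t, `|t| < d -> is_derive t (1 : R^o) (f : R^o -> _) 0) -> `|s| < d -> f s = f 0.
Proof.
move=> df sd; apply/rowP => j.
have dj (t : R) : `|t| < d -> is_derive t (1 : R^o) (fun t : R^o => f t 0 j : R^o) 0.
  move=> td; have [D E] := df t td.
  have Dj := (derivable_mxP _ _ _).1 D 0 j.
  by apply: DeriveDef => //; rewrite -derive_coord// E mxE.
have key (a b : R) : a <= b -> `|a| < d -> `|b| < d -> f b 0 j = f a 0 j.
  move=> ab ad bd.
  have abd (t : R) : a <= t <= b -> `|t| < d.
    by move: ad bd; rewrite !ltr_norml => /andP[? ?] /andP[? ?] /andP[? ?]; apply/andP; split; lra.
  have [| |t _] := @MVT_segment _ (fun t => f t 0 j) (fun=> 0) a b ab.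
  - by move=> t; rewrite in_itv/= => /andP[/ltW ? /ltW ?]; apply/dj/abd/andP.
  - apply: derivable_within_continuous => t; rewrite in_itv/= => tab.
    by have [] := dj t (abd t tab).
  by rewrite mul0r => /subr0_eq.
have d0 : `|0 : R| < d by rewrite normr0 (le_lt_trans _ sd).
by case: (lerP 0 s) => [|/ltW] s0; [exact: key|rewrite (key s 0)].
Qed.

End Calculus.

(** * Charts, tangent maps and smooth families *)

Section Charts.
Context {R : realType} {n : nat} {M : manifold R n}.
Local Notation E := 'rV[R]_n.
Implicit Types (c d : @chart R n M) (p : M) (x u v : E).

Lemma near_dom c p : dom c p -> \forall q \near p, dom c q.
Proof. by move=> cp; apply: open_nbhs_nbhs; split => //; exact: dom_open. Qed.

Lemma near_img c x : img c x -> \forall y \near x, img c y.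
Proof. by move=> cx; apply: open_nbhs_nbhs; split => //; exact: img_open. Qed.

Lemma near_inv c x (P : set M) : img c x -> nbhs (inv c x) P ->
  \forall y \near x, P (inv c y).
Proof. by move=> cx; exact: inv_continuous. Qed.

Lemma transition_differentiable c d x : atlas c -> atlas d ->
  img c x -> dom d (inv c x) -> differentiable (d \o inv c) x.
Proof. by move=> ac ad cx dx; exact: (atlas_compat ac ad [::]). Qed.

Lemma frameE c p v : dom c p ->
  frame c (c p) v = 'd (chart_at p \o inv c) (c p) v.
Proof. by move=> cp; rewrite /frame (fwdK cp). Qed.

Lemma frame_chart_at p v : frame (chart_at p) (chart_at p p) v = v.
Proof.
have dp := dom_chart_at p; have ip := fwd_img dp.
rewrite frameE//.
have E : \forall y \near chart_at p p, y = (chart_at p \o inv (chart_at p)) y.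
  by apply: filterS (near_img ip) => y iy; rewrite /= invK.
rewrite -(near_eq_diff E); last exact: ex_diff.
by rewrite diff_val.
Qed.

Lemma frame_linear c x k u v :
  frame c x (k *: u + v) = k *: frame c x u + frame c x v.
Proof. by rewrite /frame linearP. Qed.

Lemma smooth_map_differentiable (f : M -> M) c d p : smooth_map f ->
  atlas c -> atlas d -> dom c p -> dom d (f p) ->
  differentiable (d \o f \o inv c) (c p).
Proof.
move=> [_ sf] ac ad cp dp; apply: (sf _ _ ac ad [::]); split; first exact: fwd_img.
by rewrite fwdK.
Qed.

(** The differential may be computed in any charts around [p] and [f p]. For [f] equal to A_s this
    allows one target chart for all small s, whereas [tangent_map] uses the chart chosen at the
    moving point. *)
Lemma tangent_map_frame (f : M -> M) c d p u : smooth_map f ->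
  atlas c -> atlas d -> dom c p -> dom d (f p) ->
  tangent_map f p (frame c (c p) u) =
  frame d (d (f p)) ('d (d \o f \o inv c) (c p) u).
Proof.
move=> sf ac ad cp dp.
set c' := chart_at p; set d' := chart_at (f p).
have ac' : atlas c' := atlas_chart_at p.
have ad' : atlas d' := atlas_chart_at (f p).
have c'p : dom c' p := dom_chart_at p.
have d'p : dom d' (f p) := dom_chart_at (f p).
have cf : {for p, continuous f} by case: sf => + _; apply.
rewrite (frameE _ cp) (frameE _ dp) -[tangent_map f p]/(fun u => 'd (d' \o f \o inv c') (c' p) u).
have icp := fwd_img cp; have idp := fwd_img dp.
have dfc := smooth_map_differentiable sf ac ad cp dp.
have dfc' := smooth_map_differentiable sf ac' ad' c'p d'p.
have dcc' : differentiable (c' \o inv c) (c p).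
  by apply: transition_differentiable; rewrite ?fwdK.
have ddd' : differentiable (d' \o inv d) (d (f p)).
  by apply: transition_differentiable; rewrite ?fwdK.
apply: (diff_square _ _ _ dcc' dfc' dfc ddd'); rewrite /= ?(fwdK cp)//.
apply: (near_inv icp
  (P := fun q => d' (f (inv c' (c' q))) = d' (inv d (d (f q))))).
have dn : \forall q \near p, dom d (f q) := cf _ (near_dom dp).
rewrite (fwdK cp); apply: filterS2 dn (near_dom c'p) => q qd qc'.
by rewrite (fwdK qd) (fwdK qc').
Qed.

Lemma velocity_frame (g : R -> M) c (t : R) : atlas c -> dom c (g t) ->
  {for t, continuous g} -> differentiable (c \o g : R^o -> E) t ->
  velocity g t = frame c (c (g t)) ('D_1 (c \o g : R^o -> E) t).
Proof.
move=> ac cg gt dg; set d := chart_at (g t).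
have ad : atlas d := atlas_chart_at (g t).
have dgt : dom d (g t) := dom_chart_at (g t).
rewrite /velocity derive1E (frameE _ cg).
have D : differentiable (d \o inv c) ((c \o g) t).
  by apply: transition_differentiable; rewrite //= ?fwdK//; exact: fwd_img.
rewrite -[RHS](derive_comp _ dg D); apply: near_eq_derive.
have cn : \forall s \near t, dom c (g s) := gt _ (near_dom cg).
apply: filterS cn => s cs.
by rewrite /= fwdK.
Qed.

End Charts.

Section Families.
Context {R : realType} {n : nat} {M : manifold R n}.
Local Notation E := 'rV[R]_n.
Variables (F : R -> M -> M) (sF : smooth_family F).
Implicit Types (c d : @chart R n M) (p : M) (x u v : E).

Definition family_rep c d (z : R^o * E) : E := d (F z.1 (inv c z.2)).

Lemma family_rep_cvg c t x : img c x ->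
  (fun z : R^o * E => F z.1 (inv c z.2)) @ (t, x) --> F t (inv c x).
Proof.
move=> cx.
have h : (fun z : R^o * E => (z.1, inv c z.2)) @ (t, x) --> ((t : R), inv c x).
  have h2 : {for ((t, x) : R^o * E), continuous (inv c \o snd)}.
    by apply: continuous_comp; [exact: cvg_snd|exact: inv_continuous].
  exact: (cvg_pair (@cvg_fst R^o E (nbhs t) (nbhs x) _) h2).
exact: (cvg_comp _ _ h (sF.1 (t, inv c x))).
Qed.

Lemma family_dom_near c d t x : img c x -> dom d (F t (inv c x)) ->
  \forall z \near ((t, x) : R^o * E), img c z.2 /\ dom d (F z.1 (inv c z.2)).
Proof.
move=> cx dx; apply: filterI; last exact: (family_rep_cvg cx (near_dom dx)).
exact: (@cvg_snd _ _ (nbhs (t : R^o)) (nbhs x) _ _ (near_img cx)).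
Qed.

Lemma family_smooth c d vs t x : atlas c -> atlas d ->
  img c x -> dom d (F t (inv c x)) ->
  differentiable (iterD vs (family_rep c d)) ((t, x) : R^o * E).
Proof. by move=> ac ad cx dx; exact: (sF.2 c d ac ad vs (t, x)). Qed.

Lemma family_continuousl p : continuous (F ^~ p).
Proof.
move=> t; have h : (fun s : R => (s, p)) @ t --> (t, p).
  exact: (cvg_pair cvg_id (cvg_cst p)).
exact: (cvg_comp _ _ h (sF.1 (t, p))).
Qed.

Lemma family_smooth_map t : smooth_map (F t).
Proof.
split=> [p|c d ac ad vs x [/= cx dx]].
  have h : (fun q : M => (t, q)) @ p --> (t, p).
    exact: (cvg_pair (cvg_cst t) cvg_id).
  exact: (cvg_comp _ _ h (sF.1 (t, p))).
have -> : iterD vs (d \o F t \o inv c) =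
    (fun y => iterD (map (pair (0 : R^o)) vs) (family_rep c d) (t : R^o, y)).
  by apply/funext => y; rewrite -iterD_slice.
exact/differentiable_slice/family_smooth.
Qed.

Lemma family_derivable_chart c p t : atlas c -> dom c (F t p) ->
  differentiable (fun s : R^o => c (F s p)) t.
Proof.
move=> ac cp; set d := chart_at p; have dp := dom_chart_at p.
have -> : (fun s : R^o => c (F s p)) = (fun s => family_rep d c (s, d p)).
  by apply/funext => s; rewrite /family_rep/= fwdK.
apply: differentiable_slicel; apply: (family_smooth [::]) => //.
- exact: atlas_chart_at.
- exact: fwd_img.
- by rewrite fwdK.
Qed.

End Families.

(** * Circle actions preserve the symplectic form *)

Section TangentMaps.
Context {R : realType} {n : nat} {M : manifold R n}.
Local Notation E := 'rV[R]_n.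
Implicit Types (p : M) (u v : E).

Lemma tangent_map_id p u : tangent_map (id : M -> M) p u = u.
Proof. by rewrite -[RHS](frame_chart_at p) (frameE _ (dom_chart_at p)). Qed.

(** Smoothness of the composite is a hypothesis because in the application the composite of two maps
    of the action is again a map of the action. *)
Lemma tangent_map_comp (f g : M -> M) p u : smooth_map f -> smooth_map g ->
  smooth_map (g \o f) ->
  tangent_map (g \o f) p u = tangent_map g (f p) (tangent_map f p u).
Proof.
move=> sf sg sgf.
have [[dp df] dg] := (dom_chart_at p, dom_chart_at (f p), dom_chart_at (g (f p))).
have [[ap af] ag] := (atlas_chart_at p, atlas_chart_at (f p), atlas_chart_at (g (f p))).
have cf : {for p, continuous f} by case: sf => + _; apply.
have dn : \forall q \near p, dom (chart_at (f p)) (f q) := cf _ (near_dom df).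
apply: (diff_chain _ _ (smooth_map_differentiable sf ap af dp df)
  (smooth_map_differentiable sg af ag df dg)
  (smooth_map_differentiable sgf ap ag dp dg)).
  by rewrite /= (fwdK dp).
apply: (near_inv (fwd_img dp) (P := fun q => chart_at (g (f p)) (g (f q))
  = chart_at (g (f p)) (g (inv (chart_at (f p)) (chart_at (f p) (f q)))))).
by rewrite (fwdK dp); apply: filterS dn => q qd; rewrite (fwdK qd).
Qed.

Lemma pullback2_comp (w : tensor2 M) (f g : M -> M) p u v :
  smooth_map f -> smooth_map g -> smooth_map (g \o f) ->
  pullback2 (g \o f) w p u v =
  pullback2 g w (f p) (tangent_map f p u) (tangent_map f p v).
Proof.
move=> sf sg sgf; rewrite /pullback2.
by rewrite (tangent_map_comp p u sf sg sgf) (tangent_map_comp p v sf sg sgf).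
Qed.

End TangentMaps.

(** * The group law and the zeros of the generating field *)

Section Action.
Context {R : realType} {n : nat} {M : manifold R n}.
Local Notation E := 'rV[R]_n.
Variables (A : R -> M -> M) (cA : circle_action A).
Implicit Types (c d : @chart R n M) (p : M) (x u v : E).

Let sA : smooth_family A. Proof. by case: cA. Qed.
Let A0 p : A 0 p = p. Proof. by case: cA => _ ->. Qed.
Let AD s t p : A (s + t) p = A s (A t p). Proof. by case: cA. Qed.

Lemma action_velocity t p : velocity (A ^~ p) t = action_field A (A t p).
Proof.
rewrite /action_field /velocity A0 /derive1.
set F := (X in X @ _); set G := (X in _ = lim (X @ _)).
suff -> : F = G by []; apply/funext => h; rewrite /F /G /=.
by rewrite addr0 A0 AD.
Qed.

Lemma action_near_dom c p : dom c p -> \forall s \near 0, dom c (A s p).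
Proof.
move=> cp; have := @family_continuousl _ _ _ _ sA p 0 (dom c).
by rewrite A0 => /(_ (near_dom cp)).
Qed.

(** By the group law the coordinate velocity at time s is the differential of A_s applied to the
    velocity at time 0, which is 0. So the orbit is constant while it stays in the chart, and an
    arbitrary time t is reached by iterating the fixed time t/(N+1), small enough for this. *)
Lemma zero_field_fixed p : action_field A p = 0 -> fixed_point A p.
Proof.
move=> Xp; set c := chart_at p; have cp : dom c p := dom_chart_at p.
have ac : atlas c := atlas_chart_at p.
pose f (s : R) : E := c (A s p).
have [d d0 Hd] : exists2 d : R, 0 < d & forall s, `|s| < d -> dom c (A s p).
  have [d d0 Hd] := (nbhs_ballP _ _).1 (action_near_dom cp).
  by exists d => // s sd; apply: Hd; rewrite -ball_normE /= sub0r normrN.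
have f0 : 'D_1 (f : R^o -> E) 0 = 0.
  by rewrite -[RHS]Xp /action_field /velocity derive1E A0.
have df (s : R) : `|s| < d -> is_derive s (1 : R^o) (f : R^o -> E) 0.
  move=> sd; have dfs := family_derivable_chart sA ac (Hd s sd).
  apply: DeriveDef; first exact: diff_derivable.
  have d00 : `|0 : R| < d by rewrite normr0.
  have df0 : differentiable (f : R^o -> E) 0 := family_derivable_chart sA ac (Hd 0 d00).
  have dg := smooth_map_differentiable (family_smooth_map sA s) ac ac cp (Hd s sd).
  have e0 : c p = f 0 by rewrite /f A0.
  rewrite e0 in dg; have := derive_comp (1 : R^o) df0 dg.
  rewrite f0 linear0 => <-.
  rewrite (_ : 'D_1 (f : R^o -> E) s = 'D_1 (fun r : R^o => f (r + s)) (0 : R^o)); last first.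
    rewrite /derive; set F := (X in X @ _); set G := (X in _ = lim (X @ _)).
    by suff -> : F = G by []; apply/funext => h; rewrite /F /G /= addr0 add0r.
  apply: near_eq_derive; apply: filterS (action_near_dom cp) => r rd.
  by rewrite /f/= (fwdK rd) -AD addrC.
have fixs s : `|s| < d -> A s p = p.
  move=> sd; rewrite -[LHS](fwdK (Hd s sd)) -[RHS](fwdK cp); congr inv.
  by have := derive0_cst df sd; rewrite /f A0.
move=> t; have [N tN] : exists N : nat, `|t / N.+1%:R| < d.
  exists (Num.truncn (`|t| / d)).
  by rewrite normrM normfV normr_nat ltr_pdivrMr// -ltr_pdivrMl// mulrC truncnS_gt.
have iterA (k : nat) s : `|s| < d -> A (s *+ k) p = p.
  by move=> sd; elim: k => [|k IH]; rewrite ?mulr0n// mulrS AD IH fixs.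
by have := iterA N.+1 _ tN; rewrite -[_ / _ *+ _]mulr_natr divfK.
Qed.

End Action.

Section Cartan.
Context {R : realType} {n : nat} {M : manifold R n}.
Local Notation E := 'rV[R]_n.
Variables (w : tensor2 M) (w2 : two_form w)
  (dw : forall (c : @chart R n M) x u v z, atlas c -> img c x -> d2 c w x u v z = 0).
Variables (A : R -> M -> M) (A_symplectic : symplectic_action w A).
Implicit Types (c d : @chart R n M) (p : M) (x u v : E).

Let cA : circle_action A. Proof. by case: A_symplectic. Qed.
Let sA : smooth_family A. Proof. by case: cA. Qed.
Let A0 p : A 0 p = p. Proof. by case: cA => _ ->. Qed.
Let AD s t p : A (s + t) p = A s (A t p). Proof. by case: cA. Qed.

Let X := action_field A.
Let Fl c : R^o * E -> E := family_rep A c c.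
(** The generating field in the coordinates of [c]. Unlike [X], whose values refer to varying
    charts, it can be differentiated in [x]. *)
Let Xi c x : E := 'D_((1 : R^o), 0) (Fl c) ((0 : R^o), x).
Let W c x u v : R^o := coord2 c w x u v.

Let Fl0 c x : img c x -> Fl c (0, x) = x.
Proof. by move=> cx; rewrite /Fl /family_rep /= A0 invK. Qed.

Let dom0 c x : img c x -> dom c (A 0 (inv c x)).
Proof. by rewrite A0; exact: inv_dom. Qed.

Let Fl_smooth c vs x : atlas c -> img c x ->
  differentiable (iterD vs (Fl c)) ((0 : R^o), x).
Proof. by move=> ac cx; apply: family_smooth => //; exact: dom0. Qed.

Let Fl_near c x : img c x -> \forall z \near ((0 : R^o), x),
  img c z.2 /\ dom c (A z.1 (inv c z.2)).
Proof. by move=> cx; apply: family_dom_near => //; exact: dom0. Qed.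

Let X_frame c x : atlas c -> img c x -> X (inv c x) = frame c x (Xi c x).
Proof.
move=> ac cx; have dx := dom0 cx.
rewrite /X /action_field (velocity_frame ac dx).
- by rewrite /comp A0 (invK cx) /Xi -derive_slicel.
- exact: family_continuousl.
- exact: family_derivable_chart.
Qed.

Let W_l c x v : scalar (fun u => W c x u v).
Proof.
case: w2 => _ h _ _ k a b; rewrite /W /coord2 frame_linear; exact: h.
Qed.

Let W_r c x u : scalar (W c x u).
Proof.
case: w2 => h _ _ _ k a b; rewrite /W /coord2 frame_linear; exact: h.
Qed.

Let W_anti c x u v : W c x u v = - W c x v u.
Proof.
case: w2 => h1 h2 h3 _; rewrite /W /coord2.
set a := frame c x u; set b := frame c x v.
have := h3 (inv c x) (1 *: a + b); rewrite h1 !h2 !h3 !mul1r addr0 add0r.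
by move/eqP; rewrite addrC addr_eq0 => /eqP.
Qed.

Let W_diff c x u v : atlas c -> img c x ->
  differentiable (fun y => W c y u v) x.
Proof. by case: w2 => _ _ _ sw ac cx; exact: (sw c u v ac [::] x cx). Qed.

(** The first term has [Xi] frozen at [x], as in the coordinate formula for dw; only the second
    differentiates the field. This separation makes the terms of Cartan's formula cancel. *)
Let d1E c x u v : atlas c -> img c x ->
  'D_u (fun y => coord1 c (interior X w) y v : R^o) x =
  'D_u (fun y => W c y (Xi c x) v) x + W c x ('D_u (Xi c) x) v.
Proof.
move=> ac cx.
have dXi : derivable (Xi c) x u := diff_derivable (v := u)
  (differentiable_slice (Fl_smooth [:: ((1 : R^o), 0)] ac cx)).
have := is_derive_apply (L := fun y a => W c y a v) (fun y => @W_l c y v)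
  (fun a => diff_derivable (v := u) (W_diff a v ac cx)) dXi.
move=> [_ <-]; apply: near_eq_derive.
apply: filterS (near_img cx) => y cy.
by rewrite /coord1 /interior (X_frame ac cy).
Qed.

(** The linearized flow equation at time 0, obtained from the symmetry of mixed derivatives. *)
Let mixed c x u : atlas c -> img c x ->
  'D_((1 : R^o), 0) (fun z => 'D_((0 : R^o), u) (Fl c) z) ((0 : R^o), x)
  = 'D_u (Xi c) x.
Proof.
move=> ac cx; apply: etrans _ (esym (derive_slice (fun z => 'D_((1 : R^o), 0) (Fl c) z)
  (0 : R^o) x u)); apply: schwarz_rV.
- apply: filterS (Fl_near cx) => -[t y] [/= cy dy].
  exact: (family_smooth sA [::]).
- exact: (Fl_smooth [:: _]).
- exact: (Fl_smooth [:: _]).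
Qed.

Lemma pullback_action_is_derive0 p u v :
  is_derive (0 : R^o) (1 : R^o) (fun s : R^o => pullback2 (A s) w p u v : R^o) 0.
Proof.
set c := chart_at p; have cp : dom c p := dom_chart_at p.
have ac : atlas c := atlas_chart_at p.
pose x := c p; have cx : img c x := fwd_img cp.
pose F (s : R^o) := Fl c (s, x).
pose U (u : E) (s : R^o) : E := 'D_((0 : R^o), u) (Fl c) (s, x).
have F0 : F 0 = x by exact: Fl0.
have U0 a : U a 0 = a.
  rewrite /U -derive_slice -[RHS](derive_id x a).
  by apply: near_eq_derive; apply: filterS (near_img cx) => y; exact: Fl0.
have dF : differentiable F (0 : R^o).
  exact: (differentiable_slicel (Fl_smooth [::] ac cx)).
have dU a : differentiable (U a) (0 : R^o).
  exact: (differentiable_slicel (Fl_smooth [:: ((0 : R^o), a)] ac cx)).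
have F' : 'D_(1 : R^o) F 0 = Xi c x by rewrite derive_slicel.
have U' a : 'D_(1 : R^o) (U a) 0 = 'D_a (Xi c) x.
  rewrite -(mixed a ac cx).
  exact: (derive_slicel (fun z => 'D_((0 : R^o), a) (Fl c) z)).
have dW a b : is_derive (0 : R^o) (1 : R^o) (fun s : R^o => W c (F s) a b)
    ('D_(Xi c x) (fun y => W c y a b) x).
  have dWx := W_diff a b ac cx; rewrite -F0 in dWx.
  apply: DeriveDef.
    by apply: diff_derivable; apply: differentiable_comp dF dWx.
  apply: etrans (derive_comp (1 : R^o) dF dWx) _; rewrite F' F0.
  exact/esym/deriveE/W_diff.
have dWU b : is_derive (0 : R^o) (1 : R^o) (fun s : R^o => W c (F s) (U u s) b)
    ('D_(Xi c x) (fun y => W c y u b) x + W c x ('D_u (Xi c) x) b).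
  have := is_derive_apply (L := fun s a => W c (F s) a b)
    (fun s => @W_l c (F s) b) (fun a => ex_derive (is_derive := dW a b))
    (diff_derivable (v := (1 : R^o)) (dU u)).
  by rewrite U0 F0 U' (derive_val (is_derive := dW u b)).
(* Cartan: L_X w (u, v) = dw (X, u, v) + d (i_X w) (u, v) *)
have dWUV : is_derive (0 : R^o) (1 : R^o) (fun s : R^o => W c (F s) (U u s) (U v s)) 0.
  have := is_derive_apply (L := fun s b => W c (F s) (U u s) b)
    (fun s => @W_r c (F s) (U u s)) (fun b => ex_derive (is_derive := dWU b))
    (diff_derivable (v := (1 : R^o)) (dU v)).
  rewrite !U0 F0 U' (derive_val (is_derive := dWU v)) => h.
  apply: is_derive_eq h _.
  (* Add closedness of [w] on (Xi x, u, v) to closedness of i_X w on (u, v): the derivatives along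
     [u] and [v] of the coefficients with [Xi] frozen cancel, and antisymmetry identifies the rest
     with the derivative just computed. *)
  have := @dw c x (Xi c x) u v ac cx; rewrite /d2.
  have := A_symplectic.2.2 c x u v ac cx; rewrite /d1 !d1E//.
  have -> : 'D_u (fun y => coord2 c w y v (Xi c x) : R^o) x
      = - 'D_u (fun y => W c y (Xi c x) v) x.
    rewrite -deriveN; last exact/diff_derivable/W_diff.
    by congr derive; apply/funext => y; exact: W_anti.
  have := W_anti c x u ('D_v (Xi c) x); rewrite /W; lra.
apply: near_eq_is_derive dWUV.
apply: filterS (action_near_dom cA cp) => s sd.
have As := family_smooth_map sA s.
have FE : F s = c (A s p) by rewrite /F /Fl /family_rep /= (fwdK cp).
have UE a : U a s = 'd (c \o A s \o inv c) (c p) a.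
  rewrite /U -derive_slice deriveE//.
  exact: (smooth_map_differentiable As ac ac cp sd).
rewrite /W /coord2 FE !UE (fwdK sd) /pullback2.
by rewrite -[u in RHS](frame_chart_at p) -[v in RHS](frame_chart_at p)
  !(tangent_map_frame _ As ac ac cp sd).
Qed.

(* By the group law the derivative at s is a derivative at 0 for the transported data. *)
Lemma pullback_action t : pullback2 (A t) w = w.
Proof.
apply/funext => p; apply/funext => u; apply/funext => v.
pose phi (s : R) : R := pullback2 (A s) w p u v.
have -> : w p u v = phi 0.
  rewrite /phi /pullback2 (_ : A 0 = id); last exact/funext/A0.
  by rewrite !tangent_map_id.
apply: (is_derive_0_is_cst t 0) => s.
pose psi (r : R) : R := pullback2 (A r) w (A s p) (tangent_map (A s) p u)
  (tangent_map (A s) p v).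
have As r := family_smooth_map sA r.
have -> : phi = psi \o (fun r => r - s).
  apply/funext => r; rewrite /phi /psi /=.
  have AE : A r = A (r - s) \o A s by apply/funext => q /=; rewrite -AD subrK.
  have Ar := As r; rewrite AE in Ar *.
  exact: pullback2_comp.
have h1 : is_derive s 1 (fun r : R => r - s) 1.
  by rewrite -[X in is_derive _ _ _ X](subr0 1); apply: is_deriveB.
have h : is_derive (s - s) 1 psi 0.
  by rewrite subrr; exact: pullback_action_is_derive0.
apply: is_derive_eq (@is_derive1_comp _ psi (fun r : R => r - s) s _ _ h h1) _.
by rewrite ?mul0r ?mulr0.
Qed.

End Cartan.

(** * Continuity in the smooth topology; paths *)

Section CinftyContinuity.
Context {R : realType} {n : nat} {M : manifold R n}.
Local Notation E := 'rV[R]_n.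
Variables (F : R -> M -> M) (sF : smooth_family F).

(** At each point of [K] the condition is open jointly in time and space, since the spatial
    derivatives of the family are jointly continuous. Compactness of [K] then gives one time
    neighbourhood valid on all of [K], as in the tube lemma. *)
Lemma near_subbase (U : set (selfmap M)) t : Cinfty_subbase (M := M) U -> U (F t) ->
  \forall s \near t, U (F s).
Proof.
move=> [f [c [d [K [vs [e [[ac ad sf] [cK Kc Kd] e0 ->]]]]]]] Ft /=.
pose P (s : R) (x : E) := dom d (F s (inv c x)) /\
  `| iterD vs (d \o F s \o inv c) x - iterD vs (d \o f \o inv c) x | < e.
apply: ((compact_near_coveringP K).1 cK R (nbhs t) P _) => x Kx.
have [dx lte] := Ft x Kx.
have cx := Kc _ Kx.
pose g (z : R^o * E) := iterD (map (pair (0 : R^o)) vs) (family_rep F c d) z.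
have gE s y : iterD vs (d \o F s \o inv c) y = g (s, y) by exact: iterD_slice.
have cg : {for ((t : R^o), x), continuous g}.
  exact/differentiable_continuous/family_smooth.
have cf : {for ((t : R^o), x), continuous (iterD vs (d \o f \o inv c) \o snd)}.
  apply: continuous_comp; first exact: cvg_snd.
  apply/differentiable_continuous; apply: (sf.2 c d ac ad vs); split => //.
  exact: Kd.
have nP : \forall z \near ((t : R^o), x), P z.1 z.2.
  have n1 := family_dom_near sF cx dx.
  rewrite gE in lte; have n2 : \forall z \near ((t : R^o), x),
      `|g z - iterD vs (d \o f \o inv c) z.2| < e.
    exact: (cvgr_norm_lt _ (cvgB cg cf) _ lte).
  apply: filterS2 n1 n2 => -[s y] [_ /= h1] h2.
  by split => //; rewrite gE.
case: nP => -[P1 P2] /= [n1 n2] sub.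
by exists (P2, P1) => // -[y s] [/= yP sP]; exact: (sub (s, y)).
Qed.

Lemma Cinfty_continuous : continuous (F : R -> selfmap M).
Proof.
move=> t V /=; rewrite (@nbhsE (selfmap M)).
move=> [_ [[B sB <-] [C BC Ct] sUBA]].
have FF : Filter ((F : R -> selfmap M) @ t) by exact: fmap_filter.
suff : ((F : R -> selfmap M) @ t) C.
  by apply: filterS => s Cs; apply: sUBA; exists C.
have /sB [D sD IDeC] := BC; rewrite -IDeC; apply: filter_bigI => U DU.
have := sD _ DU; rewrite inE => sU.
by apply: near_subbase => //; move: Ct; rewrite -IDeC => /(_ _ DU).
Qed.

Lemma family_Symp0 (w : tensor2 M) : F 0 = id ->
  (forall t, symplectomorphism w (F t)) ->
  forall t, `[0, 1]%classic t -> Symp0 w (F t).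
Proof.
move=> F0 sympF t It.
apply: (connected_component_max (B := (F : R -> selfmap M) @` `[0, 1])).
- by exists 0; rewrite //= in_itv /= lexx ler01.
- by move=> _ [s _ <-]; exact: sympF.
- apply: connected_continuous_connected; first exact: segment_connected.
  exact/continuous_subspaceT/Cinfty_continuous.
- by exists t.
Qed.

End CinftyContinuity.

(** * Path-connectedness of connected manifolds *)

Section Paths.
Context {R : realType} {T : topologicalType}.
Implicit Types x y z : T.

(** Paths are continuous on all of [R], so that they compose with continuous parameters without
    tracking subspaces. *)
Definition joined x y := exists g : R -> T, [/\ continuous g, g 0 = x & g 1 = y].

Lemma joined_sym x y : joined x y -> joined y x.
Proof.
move=> [g [cg g0 g1]]; exists (g \o (fun t => 1 - t)); split.
- move=> t; apply: continuous_comp; last exact: cg.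
  by apply: cvgB; [exact: cvg_cst|exact: cvg_id].
- by rewrite /= subr0.
- by rewrite /= subrr.
Qed.

Lemma joined_trans x y z : joined x y -> joined y z -> joined x z.
Proof.
move=> [f [cf f0 f1]] [g [cg g0 g1]].
exists (cat_fun f g); split.
- apply/continuous_subspace_setT.
  apply: (@within_glue _ _ _ setT id (f \o (fun t => 2 * t)) (g \o (fun t => 2 * t - 1))).
  + exact: closedT.
  + by move=> ?; exact: cvg_id.
  + apply: continuous_subspaceT => t; apply: continuous_comp; last exact: cf.
    by apply: cvgM; [exact: cvg_cst|exact: cvg_id].
  + apply: continuous_subspaceT => t; apply: continuous_comp; last exact: cg.
    by apply: cvgB; [apply: cvgM; [exact: cvg_cst|exact: cvg_id]|exact: cvg_cst].
  + by move=> t _ /= ->; rewrite divff// subrr f1 g0.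
- by rewrite /cat_fun invr_ge0 ler0n mulr0.
- rewrite /cat_fun ifF; last by apply/negbTE; rewrite -ltNge; lra.
  by rewrite (_ : 2 * 1 - 1 = 1) //; lra.
Qed.

(** Under the local hypothesis the points joined to [x] form an open set with open complement. *)
Lemma connected_joined x y : connected [set: T] ->
  (forall z, \forall u \near z, joined z u) -> joined x y.
Proof.
move=> cT lj; suff -> : joined x = setT by [].
apply: cT.
- by exists x; apply: nbhs_singleton (lj x).
- exists (joined x); last by rewrite setTI.
  rewrite openE => z xz; apply: filterS (lj z) => u zu.
  exact: joined_trans xz zu.
- exists (joined x); last by rewrite setTI.
  rewrite -[joined x]setCK; apply: open_closedC; rewrite openE => z xz.
  apply: filterS (lj z) => u zu xu; apply: xz.
  exact: joined_trans xu (joined_sym zu).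
Qed.

End Paths.

Lemma clamp_continuous {R : realType} :
  continuous (fun t : R => Num.max 0 (Num.min 1 t)).
Proof.
move=> t.
have h : {for t, continuous ((cst 1 : R -> R^o) \min id)}.
  by apply: continuous_min; [exact: cvg_cst|exact: cvg_id].
exact: (continuous_max (f := (cst 0 : R -> R^o)) (cvg_cst _) h).
Qed.

Lemma clamp_itv {R : realType} (t : R) : 0 <= Num.max 0 (Num.min 1 t) <= 1.
Proof. by rewrite le_max lexx /= ge_max ler01 ge_min lexx. Qed.

Lemma manifold_locally_joined {R : realType} {n : nat} (M : manifold R n) (p : M) :
  \forall q \near p, joined (R := R) p q.
Proof.
set c := chart_at p; have cp : dom c p := dom_chart_at p.
have [r r0 Hr] := (nbhs_ballP _ _).1 (near_img (fwd_img cp)).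
have nr : \forall q \near p, ball (c p) r (c q).
  exact: (fwd_continuous cp (nbhsx_ballx _ _ r0)).
apply: filterS2 (near_dom cp) nr => q cq qr.
(* Clamping the parameter keeps the segment inside the ball, hence in the image of the chart, for
   every real [t]. *)
pose b (t : R) := Num.max 0 (Num.min 1 t).
pose l (t : R) := c p + b t *: (c q - c p).
exists (inv c \o l); split.
- move=> t; apply: continuous_comp.
    apply: cvgD; first exact: cvg_cst.
    by apply: cvgZr_tmp; exact: clamp_continuous.
  apply: inv_continuous; apply: Hr; move: qr; rewrite -!ball_normE /= /l.
  rewrite opprD addrA subrr sub0r normrN normrZ distrC; apply: le_lt_trans.
  have /andP[b0 b1] := clamp_itv t.
  by rewrite (ger0_norm b0) ler_piMl.
- by rewrite /= /l /b min_r ?ler01// maxxx scale0r addr0 fwdK.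
- by rewrite /= /l /b minxx max_r ?ler01// scale1r addrC subrK fwdK.
Qed.

(** * Contracting orbits; fluxes *)

Section NullLoop.
Context {R : realType} {T : topologicalType} (x0 p : T).
Local Notation clamp t := (Num.max 0 (Num.min 1 t)).

Lemma clamp_le0 (t : R) : t <= 0 -> clamp t = 0.
Proof. by move=> t0; rewrite min_r ?(le_trans t0)// max_l. Qed.

Lemma clamp_ge1 (t : R) : 1 <= t -> clamp t = 1.
Proof. by move=> t1; rewrite min_l// max_r. Qed.

Lemma hclassP (f g : loop (R := R) x0) : homotopic f g -> hclass f = hclass g.
Proof. by move=> fg; apply/(@eqmodP _ homotopic_equiv)/asboolP. Qed.

Variables (F : R -> T -> T) (cF : continuous (fun z : R * T => F z.1 z.2))
  (F0 : F 0 = id) (F1 : F 1 = id) (Fp : forall t, F t p = p).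

(* In the square (u, t) |-> F t (g u) the edge u = 0 is the loop, the edge u = 1
   is constant and the edges t = 0 and t = 1 are both g. Hence the loop is homotopic
   to (sigma, tau), which runs through the last three edges, i.e. to g \o sigma. *)
Lemma hclass_orbit_fixed (f k : loop (R := R) x0) : joined (R := R) x0 p ->
  (forall t, f t = F t x0) -> (forall t, k t = x0) -> hclass f = hclass k.
Proof.
move=> [g [cg g0 g1]] fE kE.
(* One edge per third of [0, 1]: [sigma] rises, stays at 1, then falls, while [tau] stays at 0,
   rises, then stays at 1. *)
pose sigma (t : R) := clamp (Num.min (3 * t) (3 - 3 * t)).
pose tau (t : R) := clamp (3 * t - 1).
have c3 : continuous (fun t : R => 3 * t).
  by move=> t; apply: cvgM; [exact: cvg_cst|exact: cvg_id].
have cc (f' : R -> R) : continuous f' -> continuous (fun t => clamp (f' t)).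
  move=> cf' t; apply: (@continuous_comp _ _ _ f' (fun t => clamp t)); first exact: cf'.
  exact: clamp_continuous.
have csigma : continuous sigma.
  apply: cc => t.
  apply: (@continuous_min _ _ (fun t : R => 3 * t : R^o) (fun t : R => 3 - 3 * t : R^o)).
    exact: c3.
  by apply: cvgB; [exact: cvg_cst|exact: c3].
have ctau : continuous tau.
  apply: cc => t.
  by apply: cvgB; [exact: c3|exact: cvg_cst].
have sigma0 : sigma 0 = 0 by rewrite /sigma clamp_le0// ge_min mulr0 lexx.
have sigma1 : sigma 1 = 0.
  by rewrite /sigma clamp_le0// ge_min mulr1 subrr lexx orbT.
have tau0 : tau 0 = 0 by rewrite /tau clamp_le0// mulr0 sub0r oppr_le0 ler01.
have tau1 : tau 1 = 1 by rewrite /tau clamp_ge1//; lra.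
have cm : {within `[0, 1], continuous (g \o sigma)}.
  apply: continuous_subspaceT => t.
  by apply: continuous_comp; [exact: csigma|exact: cg].
have m0 : (g \o sigma) 0 = x0 by rewrite /= sigma0.
have m1 : (g \o sigma) 1 = x0 by rewrite /= sigma1.
pose m := Loop cm m0 m1.
have cfst : continuous (fst : R * R -> R) by move=> z; exact: cvg_fst.
have csnd : continuous (snd : R * R -> R) by move=> z; exact: cvg_snd.
have cs2 : continuous (fun z : R * R => sigma z.2).
  by move=> z; apply: continuous_comp; [exact: csnd|exact: csigma].
have ct2 : continuous (fun z : R * R => tau z.2).
  by move=> z; apply: continuous_comp; [exact: csnd|exact: ctau].
have c1 : continuous (fun z : R * R => 1 - z.1).
  by move=> z; apply: cvgB; [exact: cvg_cst|exact: cfst].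
have cM (a b : R * R -> R) : continuous a -> continuous b -> continuous (fun z => a z * b z).
  by move=> ca cb z; apply: cvgM; [exact: ca|exact: cb].
transitivity (hclass m); apply: hclassP.
(* The square is convex: this is the straight-line homotopy in it from (0, t) to (sigma t, tau t),
   composed with (u, t) |-> F t (g u). *)
- exists (fun z => F ((1 - z.1) * z.2 + z.1 * tau z.2) (g (z.1 * sigma z.2))); split.
  + apply: continuous_subspaceT => z.
    have ca : {for z, continuous (fun z : R * R => (1 - z.1) * z.2 + z.1 * tau z.2)}.
      by apply: cvgD; exact: cM.
    have cb : {for z, continuous (fun z : R * R => g (z.1 * sigma z.2))}.
      by apply: continuous_comp; [exact: cM|exact: cg].
    apply: (@continuous_comp _ _ _ (fun z : R * R => ((1 - z.1) * z.2 + z.1 * tau z.2,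
      g (z.1 * sigma z.2))) (fun y => F y.1 y.2)); last exact: cF.
    exact: (cvg_pair ca cb).
  + by move=> t _ /=; rewrite subr0 mul1r !mul0r addr0 g0 fE.
  + move=> t _ /=; rewrite subrr mul0r add0r !mul1r.
    (* On the outer thirds [tau] is 0 or 1 and [F] is the identity; on the middle third [sigma] is 1
       and [g 1 = p] is fixed. *)
    have [t1|t1] := leP (3 * t) 1.
      by rewrite /tau clamp_le0 ?subr_le0// F0.
    have [t2|t2] := leP 2 (3 * t).
      by rewrite /tau clamp_ge1 ?F1//; lra.
    by rewrite /sigma clamp_ge1 ?g1// le_min; apply/andP; split; lra.
  + move=> s _ /=; rewrite sigma0 sigma1 tau0 tau1 !mulr0 !mulr1 addr0 subrK.
    by rewrite F0 F1 g0.
(* The loop [g \o sigma] runs along [g] and back, so scaling [sigma] to 0 contracts it with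
   endpoints fixed. *)
- exists (fun z => g ((1 - z.1) * sigma z.2)); split.
  + apply: continuous_subspaceT => z.
    by apply: continuous_comp; [exact: cM|exact: cg].
  + by move=> t _ /=; rewrite subr0 mul1r.
  + by move=> t _ /=; rewrite subrr mul0r kE.
  + by move=> s _ /=; rewrite sigma0 sigma1 !mulr0.
Qed.

End NullLoop.

Section ConstantFamily.
Context {R : realType} {n : nat} {M : manifold R n}.

Lemma smooth_family_id : smooth_family (fun _ : R => id : M -> M).
Proof.
split=> [z|c d ac ad vs [t x] [/= cx dx]]; first exact: cvg_snd.
have -> : iterD vs (fun z : R^o * 'rV[R]_n => d (inv c z.2)) =
    (fun z => iterD (map snd vs) (d \o inv c) z.2).
  elim: vs => [//|[a v] vs IH] /=; apply/funext => -[s y]; rewrite IH /derive /=.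
  by [].
apply: (@differentiable_comp _ _ _ _ snd (iterD (map snd vs) (d \o inv c))).
  by apply: linear_differentiable => z; exact: cvg_snd.
exact: (atlas_compat ac ad).
Qed.

Lemma velocity_cst (p : M) (t : R) : velocity (fun _ : R => p) t = 0.
Proof. by rewrite /velocity derive1_cst. Qed.

End ConstantFamily.

(** * Smooth functions at a maximum *)

Section MaximumPrinciple.
Context {R : realType} {n : nat} {M : manifold R n}.

Lemma smooth_fun_continuous (h : M -> R) : smooth_fun h -> continuous h.
Proof.
move=> sh p; set c := chart_at p; have cp : dom c p := dom_chart_at p.
have dh : {for c p, continuous (h \o inv c : _ -> R^o)}.
  apply/differentiable_continuous; apply: (sh c _ [::]); first exact: atlas_chart_at.
  exact: fwd_img.
have hc : (h \o inv c) \o c @ p --> ((h \o inv c) \o c) p.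
  exact: (continuous_comp (fwd_continuous cp) dh).
rewrite {2}/comp /= (fwdK cp) in hc; apply: cvg_trans hc; apply: near_eq_cvg.
by apply: filterS (near_dom cp) => q qd /=; rewrite (fwdK qd).
Qed.

(** Fermat's rule along the coordinate line through [c p] in direction [v], restricted to the
    parameters for which it stays in the image of the chart. *)
Lemma dfun_max (h : M -> R) p v : smooth_fun h -> (forall q, h q <= h p) ->
  dfun h p v = 0.
Proof.
move=> sh hmax; set c := chart_at p; have cp : dom c p := dom_chart_at p.
have ac : atlas c := atlas_chart_at p.
pose f := h \o inv c : 'rV[R]_n -> R^o.
have df x : img c x -> differentiable f x by move=> cx; exact: (sh c ac [::]).
have [r r0 Hr] : exists2 r : R, 0 < r & forall s : R, `|s| < r -> img c (c p + s *: v).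
  have nimg := near_img (fwd_img cp).
  have cl : {for (0 : R), continuous (fun s : R => c p + s *: v)}.
    by apply: cvgD; [exact: cvg_cst|apply: cvgZr_tmp; exact: cvg_id].
  have ns : \forall s \near (0 : R), img c (c p + s *: v).
    by apply: cl; rewrite scale0r addr0.
  have [r r0 Hr] := (nbhs_ballP _ _).1 ns.
  by exists r => // s sr; apply: Hr; rewrite -ball_normE /= sub0r normrN.
pose g (s : R) : R := f (c p + s *: v).
have dg (s : R) : `|s| < r -> is_derive s 1 g ('D_v f (c p + s *: v)).
  by move=> sr; apply: is_derive_line; exact/df/Hr.
have rr (t : R) : t \in `](- r), r[%R -> `|t| < r by rewrite in_itv/= ltr_norml.
have z : (0 : R) \in `](- r), r[%R by rewrite in_itv/= oppr_lt0 r0.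
have [_ g0] : is_derive (0 : R) 1 g 0.
  apply: (@derive1_at_max _ g (- r) r 0) => //.
  - by rewrite ltW// gtrN.
  - by move=> t /rr tr; have [] := dg t tr.
  - by move=> t _; rewrite /g /f /= scale0r addr0 (fwdK cp); exact: hmax.
have [_ g0'] := dg 0 (rr _ z).
rewrite /dfun -/c -deriveE; last exact/df/fwd_img.
by rewrite -g0 g0' scale0r addr0.
Qed.

End MaximumPrinciple.

(** * Flux of a family generated by a time-independent field *)

Section FluxOfActions.
Context {R : realType} {n : nat} {M : manifold R n} (w : tensor2 M).

Lemma Rintegral01_cst (r : R) :
  \int[lebesgue_measure]_(t in (`[0, 1]%classic : set R)) r = r.
Proof.
rewrite /Rintegral integral_cst//= lebesgue_measure_itv/= lte_fin ltr01.
by rewrite oppr0 adde0 mule1.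
Qed.

Lemma has_flux_stationary (F : R -> M -> M) (X : vfield M) (b : closed1 M) :
  (forall t p, velocity (F ^~ p) t = X (F t p)) ->
  (b : tensor1 M) = interior X w -> has_flux w F (class1 b).
Proof.
move=> XF bE; exists (fun=> X), b; split=> // p v.
by rewrite Rintegral01_cst bE.
Qed.

Lemma class1_eq0 (b : closed1 M) : class1 b = class1 0 -> exact_one_form (b : tensor1 M).
Proof.
move=> /eqP; rewrite eqmodE => /asboolP.
by rewrite subr0.
Qed.

End FluxOfActions.

Theorem proposition1p5 (R : realType) (n : nat) (M : manifold R n)
    (M_compact : compact [set: M]) (M_connected : connected [set: M])
    (w : tensor2 M) (w_symplectic : symplectic_form w)
    (x0 : M) (e : flux_group w -> pi1 R x0)
    (e_hom : e_homomorphism e) (e_inj : injective e)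
    (A : R -> M -> M) (A_symplectic : symplectic_action w A) :
  hamiltonian_action w A <-> exists p, fixed_point A p.
Proof.
have [w2 dw w_nondeg] := w_symplectic.
have [cA closedX] := A_symplectic.
have [sA A0 AD A1] := cA.
split=> [[_ [h sh XE]]|[p Ap]].
  (* The base point [x0] supplies the nonemptiness that the extreme value theorem asks for. *)
  have [||p _ hmax] := @compact_EVT_max _ _ h setT _ M_compact; first by exists x0.
    exact/continuous_subspaceT/smooth_fun_continuous.
  exists p; apply: (zero_field_fixed cA); apply: (w_nondeg p) => v.
  rewrite -[LHS]/(interior (action_field A) w p v) XE.
  by apply: dfun_max => // q; apply: hmax; rewrite inE.
have sympA t : symplectomorphism w (A t).
  split; [exact: family_smooth_map| |exact: pullback_action].
  exists (A (- t)); split; first exact: family_smooth_map.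
    by move=> q; rewrite -AD addNr A0.
  by move=> q; rewrite -AD subrr A0.
pose LA := SympLoop sA (family_Symp0 sA A0 sympA) A0 A1.
(* The identity is [A 0], so this is an instance of [sympA]. *)
have symp_id : symplectomorphism w (id : M -> M) by rewrite -A0.
pose Lid := SympLoop smooth_family_id
  (family_Symp0 smooth_family_id erefl (fun=> symp_id)) erefl erefl.
have closedXb : interior (action_field A) w \in @closed1_pred R n M by apply/asboolP.
pose b : closed1 M := Closed1 closedXb.
have fluxA : has_flux w LA (class1 b).
  by apply: has_flux_stationary => // t q; exact: action_velocity.
have flux0 : has_flux w Lid (class1 0).
  apply: (@has_flux_stationary _ _ _ _ _ (fun=> 0)) => [t q|].
    exact: velocity_cst.
  apply/funext => q; apply/funext => v; rewrite /interior.
  (* Linearity at the coefficient -1 and the zero vector makes [w q 0 v] the sum of itself and its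
     opposite, hence 0. *)
  have [_ h _ _] := w2; have := h q v (-1) 0 0.
  by rewrite scaler0 addr0 => ->; rewrite mulN1r addNr.
pose a1 : flux_group w := exist _ (class1 b) (mem_set (ex_intro _ LA fluxA)).
pose a0 : flux_group w := exist _ (class1 0) (mem_set (ex_intro _ Lid flux0)).
have ea : e a1 = e a0.
  rewrite (e_hom.2 LA a1 fluxA) (e_hom.2 Lid a0 flux0).
  apply: (hclass_orbit_fixed (p := p) (F := A)) => //; first exact: sA.1.
  by apply: connected_joined => // z; exact: manifold_locally_joined.
split=> //; apply: (class1_eq0 (b := b)).
exact: (congr1 val (e_inj _ _ ea)).
Qed.
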